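(* Assume that $X$ is a time-homogeneous Markov process having the FOED property with function of evolution of distribution $F$, with initial distribution $\gamma$ whose support is $E$. Let $n\in\mathbb{N}$, $0=t_0<t_1<\ldots<t_n$, and let $f_0,f_1,\ldots,f_n$ be bounded Borel functions on $E$. Define recursively $$h_1=\Lambda_{t_1}f_0,\qquad h_{k+1}=\Lambda_{t_{k+1}-t_k}\Big(f_k(\cdot)\,e^{\int_0^{t_k-t_{k-1}}F(u,\cdot)du}\,h_k(\cdot)\Big),\quad 1\le k\le n-1.$$ Then $$\mathbb{E}\big(f_0(X_0)f_1(X_{t_1})\cdots f_n(X_{t_n})\big)=\mathbb{E}\Big(f_n(X_0)\,e^{\int_0^{t_n-t_{n-1}}F(u,X_0)du}\,h_n(X_0)\Big).$$
   Context: Setting: $(\Omega,\mathcal{F},\mathbb{P})$ is a complete probability space; $X=(X_t)_{t\ge0}$ is a càdlàg process with values in a Polish space $(E,\mathcal{E})$, with non-atomic initial distribution $\gamma$. ''Markov'' is with respect to the filtration generated by $X$, augmented to satisfy the usual conditions. FOED property: $X$ has the FOED property if there is a Borel measurable $F:\mathbb{R}_+\times E\to\mathbb{R}$ such that for every $y\in E$ the function $u\mapsto F(u,y)$ is locally integrable and $\mathbb{E}f(X_t)=\mathbb{E}\big(f(X_0)e^{\int_0^tF(u,X_0)du}\big)$ for every bounded Borel function $f$ on $E$ and every $t\ge0$. Such an $F$ is called the function of evolution of distribution of $X$. Bridge operator: for $t\ge0$ and $f\in L^1(\gamma)=L^1(E,\mathcal{B}(E),\gamma)$, $\Lambda_tf$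 is the function on $E$ given by $\Lambda_tf(z)=\mathbb{E}(f(X_0)\,|\,X_t=z)$, i.e. $\Lambda_tf=h$ where $h$ is Borel with $\mathbb{E}(f(X_0)|X_t)=h(X_t)$. It is always assumed that $(t,z)\mapsto\Lambda_tf(z)$ is measurable. *)

(* Defs.v *)
From HB Require Import structures.
From mathcomp Require Import all_boot all_order all_algebra.
From mathcomp Require Import all_classical all_reals all_analysis.
From mathcomp Require Import measurable_realfun.
Set Implicit Arguments.
Unset Strict Implicit.
Unset Printing Implicit Defensive.
Import Order.TTheory GRing.Theory Num.Theory.
Import numFieldNormedType.Exports.

Local Open Scope classical_set_scope.
Local Open Scope ring_scope.

(* A topological space equipped with its Borel sigma-algebra. *)
Notation borel E := (g_sigma_algebraType (@open E)).

(* Nonnegativity of the metric follows from the other clauses. *)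
Definition polish (R : realType) (E : topologicalType) : Prop :=
  (exists D : set E, countable D /\ dense D) /\
  exists dist : E -> E -> R,
    [/\ forall x y, dist x y = 0 <-> x = y,
        forall x y, dist x y = dist y x,
        forall x y z, dist x z <= dist x y + dist y z,
        forall x (A : set E),
          nbhs x A <-> exists2 e, 0 < e & [set y | dist x y < e] `<=` A
      & forall u : nat -> E,
          (forall e, 0 < e -> exists N, forall i j,
             (N <= i)%N -> (N <= j)%N -> dist (u i) (u j) < e) ->
          exists l : E, u @ \oo --> l].

Section measures.
Context d (T : measurableType d) (R : realType).
Implicit Types (mu : {measure set T -> \bar R}).

Definition atom mu (A : set T) : Prop :=
  [/\ measurable A, (0 < mu A)%E &
      forall B, measurable B -> B `<=` A -> mu B = 0%E \/ mu B = mu A].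

Definition non_atomic mu : Prop := forall A, ~ atom mu A.

End measures.

Definition measure_support (R : realType) (E : ptopologicalType)
    (mu : {measure set (borel E) -> \bar R}) : set E :=
  [set x | forall U : set E, open U -> U x -> (0 < mu U)%E].

(* Z is a version of the conditional expectation of the integrable variable Y
   given the sigma-algebra G. *)
Definition is_cond_exp d (T : measurableType d) (R : realType)
    (P : probability T R) (G : set (set T)) (Y Z : T -> R) : Prop :=
  [/\ g_sigma_algebra_preimage Z `<=` G,
      P.-integrable setT (EFin \o Z) &
      forall A, G A ->
        (\int[P]_(w in A) (Z w)%:E = \int[P]_(w in A) (Y w)%:E)%E].

Section process.
Context d (T : measurableType d) (R : realType) (P : probability T R).
Context (E : ptopologicalType).

Definition bounded_borel (f : borel E -> R) : Prop :=
  measurable_fun setT f /\ bounded_fun f.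

(* Processes are indexed by all of R for convenience; only the values at
   nonnegative times ever matter. *)
Variable X : R -> {RV P >-> borel E}.

Definition cadlag : Prop := forall w : T,
  (forall t : R, 0 <= t ->
     (fun s => X s w : E) @ t^'+ --> (X t w : E)) /\
  (forall t : R, 0 < t ->
     exists l : E, (fun s => X s w : E) @ t^'- --> l).

Definition natural_filtration (t : R) : set (set T) :=
  <<s \bigcup_(s in `[0, t]) g_sigma_algebra_preimage (X s) >>.

Definition augmented_filtration (t : R) : set (set T) :=
  \bigcap_(s in `]t, +oo[) <<s natural_filtration s `|` P.-negligible >>.

Definition homogeneous_markov : Prop :=
  exists kappa : R -> R.-pker borel E ~> borel E,
  forall (s t : R) (f : borel E -> R), 0 <= s -> 0 <= t -> bounded_borel f ->
    is_cond_exp P (augmented_filtration s)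
      (fun w => f (X (s + t) w))
      (fun w => \int[kappa t (X s w)]_y f y)%R.

Definition initial_distribution : probability (borel E) R :=
  distribution P (X 0).

(* exp (\int_0^t F(u, z) du) *)
Definition evolution_density (F : R -> borel E -> R) (t : R) (z : borel E) : R :=
  expR (\int[lebesgue_measure]_(u in `[0, t]) F u z)%R.

(* Being locally integrable on [0, +oo[ is being integrable on each [0, t]. *)
Definition evolution_of_distribution (F : R -> borel E -> R) : Prop :=
  [/\ measurable_fun [set p : R * borel E | 0 <= p.1] (fun p => F p.1 p.2),
      forall (y : borel E) (t : R), 0 <= t ->
        lebesgue_measure.-integrable `[0, t] (fun u : R => (F u y)%:E) &
      forall (f : borel E -> R) (t : R), bounded_borel f -> 0 <= t ->
        ('E_P[fun w => f (X t w)] =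
         'E_P[fun w => (f (X 0 w) * evolution_density F t (X 0 w))%R])%E].

(* Lambda t f is a version of z |-> E(f(X_0) | X_t = z), jointly measurable
   in (t, z). *)
Definition bridge_operator
    (Lambda : R -> (borel E -> R) -> borel E -> R) : Prop :=
  forall f : borel E -> R,
    initial_distribution.-integrable setT (EFin \o f) ->
    [/\ measurable_fun [set p : R * borel E | 0 <= p.1]
          (fun p => Lambda p.1 f p.2),
        forall t : R, 0 <= t -> measurable_fun setT (Lambda t f) &
        forall t : R, 0 <= t ->
          is_cond_exp P (g_sigma_algebra_preimage (X t))
            (fun w => f (X 0 w)) (fun w => Lambda t f (X t w))].

End process.

(* Main.v *)
Require Import Defs.
From HB Require Import structures.
From mathcomp Require Import all_boot all_order all_algebra.
From mathcomp Require Import all_classical all_reals all_analysis.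
From mathcomp Require Import measurable_realfun.
Import Order.TTheory GRing.Theory Num.Theory.
Import numFieldNormedType.Exports.
Local Open Scope classical_set_scope.
Local Open Scope ring_scope.

(* Write rho_s = exp (int_0^s F(u, .) du) and kappa_s for the transition kernel.
   Conditioning on X_s and then applying the FOED property to the
   (unbounded) function v * Lambda_s q gives, for v bounded and q(X_0)
   integrable,
     E (q(X_0) v(X_s)) = E (v(X_0) rho_s(X_0) (Lambda_s q)(X_0)).
   The theorem follows by induction on n, for all bounded v in place of f_n at
   once. The Markov property at t_n replaces v(X_{t_{n+1}}) by
   (kappa_s v)(X_{t_n}) with s = t_{n+1} - t_n; the induction hypothesis moves
   everything to X_0, giving E (q(X_0) (kappa_s v)(X_0)) with
   q = f_n rho_{t_n - t_{n-1}} h_n; the Markov property at 0 turns this into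
   E (q(X_0) v(X_s)), to which the formula above applies. *)

(** * Images of weighted measures, and products with conditional expectations *)

Section weighted_transfer.
Context d d' (T : measurableType d) (S : measurableType d') (R : realType).
Variable mu : {measure set T -> \bar R}.
Local Open Scope ereal_scope.
Import HBNNSimple.

(** Monotone convergence along simple functions increasing to [g]. On the right, [a] and [p] occur
    only through the integrals of [p] over preimages under [a], that is, through the image under [a]
    of the measure with density [p]. *)
Lemma ge0_integral_weighted_approx (a : T -> S) (p : T -> R) (g : S -> \bar R)
    (mg : measurable_fun setT g) :
  measurable_fun setT a -> measurable_fun setT p ->
  (forall x, (0 <= p x)%R) -> (forall y, 0 <= g y) ->
  \int[mu]_x (g (a x) * (p x)%:E) =
  limn (fun n => \sum_(k \in range (nnsfun_approx measurableT mg n))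
    (k%:E *
     \int[mu]_(x in a @^-1` (nnsfun_approx measurableT mg n @^-1` [set k]))
       (p x)%:E)).
Proof.
move=> ma mp p0 g0; set h := nnsfun_approx measurableT mg.
have mpE : measurable_fun setT (EFin \o p) by exact/measurable_EFinP.
have mpre (A : set S) : measurable A -> measurable (a @^-1` A).
  by move=> mA; rewrite -[_ @^-1` _]setTI; exact: ma.
have gE x : g (a x) * (p x)%:E = limn (fun n => (h n (a x))%:E * (p x)%:E).
  apply/esym/cvg_lim => //; apply: cvgeZr => //.
  by apply: cvg_nnsfun_approx.
under eq_integral do rewrite gE.
rewrite monotone_convergence//; last 3 first.
- move=> n; apply: emeasurable_funM => //; apply/measurable_EFinP.
  exact: measurableT_comp.
- by move=> n x _; rewrite mule_ge0 ?lee_fin.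
- move=> x _ i j ij; rewrite lee_wpmul2r ?lee_fin//.
  exact/lefP/nd_nnsfun_approx.
congr (limn _); apply/funext => n.
have mind k : measurable_fun setT
    (fun x => (k * \1_(h n @^-1` [set k]) (a x))%:E * (p x)%:E).
  apply: emeasurable_funM => //; apply/measurable_EFinP.
  by apply: measurable_funM => //; exact: measurableT_comp.
(* A simple function is the finite sum of its values times the indicators of its level sets. *)
transitivity (\int[mu]_x (\sum_(k \in range (h n))
    ((k * \1_(h n @^-1` [set k]) (a x))%:E * (p x)%:E))).
  apply: eq_integral => x _.
  rewrite -ge0_mule_fsuml => [|k]; last exact: nnfun_muleindic_ge0.
  by rewrite fsumEFin// -fimfunE.
rewrite ge0_integral_fsum//; last first.
  by move=> k x _; rewrite mule_ge0 ?lee_fin//; exact: nnfun_muleindic_ge0.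
apply: eq_fsbigr => k kh.
under eq_integral do rewrite EFinM -muleA.
rewrite ge0_integralZl//.
- congr (_ * _); rewrite [RHS]integral_mkcond; apply: eq_integral => x _.
  by rewrite epatch_indic muleC indicE.
- apply: emeasurable_funM => //; apply/measurable_EFinP.
  by apply: measurableT_comp.
- by move=> x _; rewrite mule_ge0 ?lee_fin.
- by move: kh; rewrite inE => -[t _ <-]; rewrite lee_fin.
Qed.

Variables (a b : T -> S) (p q : T -> R).
Hypotheses (ma : measurable_fun setT a) (mb : measurable_fun setT b).
Hypotheses (mp : measurable_fun setT p) (mq : measurable_fun setT q).
Hypotheses (p0 : forall x, (0 <= p x)%R) (q0 : forall x, (0 <= q x)%R).
Hypothesis pq : forall A, measurable A ->
  \int[mu]_(x in a @^-1` A) (p x)%:E = \int[mu]_(x in b @^-1` A) (q x)%:E.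

(** The simple functions approximating [g] live on [S] and are the same on both sides, so [pq] makes
    the two limits agree term by term. *)
Lemma ge0_weighted_transfer (g : S -> \bar R) :
  measurable_fun setT g -> (forall y, 0 <= g y) ->
  \int[mu]_x (g (a x) * (p x)%:E) = \int[mu]_x (g (b x) * (q x)%:E).
Proof.
move=> mg g0; rewrite !(@ge0_integral_weighted_approx _ _ g mg)//.
congr (limn _); apply/funext => n; apply: eq_fsbigr => k _.
by rewrite pq.
Qed.

Lemma weighted_transfer_integrable (g : S -> R) :
  measurable_fun setT g ->
  mu.-integrable setT (fun x => (g (b x) * q x)%:E) ->
  mu.-integrable setT (fun x => (g (a x) * p x)%:E).
Proof.
move=> mg /integrableP[_ oo]; apply/integrableP; split.
  by apply/measurable_EFinP/measurable_funM => //; exact: measurableT_comp.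
move: oo; under eq_integral do
  rewrite EFinM abseM [`|(q _)%:E|]gee0_abs ?lee_fin//.
under [in X in _ -> X]eq_integral do
  rewrite EFinM abseM [`|(p _)%:E|]gee0_abs ?lee_fin//.
rewrite (@ge0_weighted_transfer (fun y => `|(g y)%:E|))//.
by apply: measurableT_comp => //; exact/measurable_EFinP.
Qed.

(** The integral is the difference of those of the positive and negative parts, and a nonnegative
    weight factors out of both parts, so the nonnegative case applies to each. *)
Lemma weighted_transfer (g : S -> R) :
  measurable_fun setT g ->
  \int[mu]_x (g (a x) * p x)%:E = \int[mu]_x (g (b x) * q x)%:E.
Proof.
have aux (c : T -> S) (r : T -> R) : (forall x, (0 <= r x)%R) ->
    \int[mu]_x (g (c x) * r x)%:E =
    \int[mu]_x ((EFin \o g)^\+ (c x) * (r x)%:E) -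
    \int[mu]_x ((EFin \o g)^\- (c x) * (r x)%:E).
  move=> r0; rewrite integralE; congr (_ - _); apply: eq_integral => x _.
    by rewrite !funeposE/= EFinM maxe_pMl ?lee_fin// mul0e.
  by rewrite !funenegE maxe_pMl ?lee_fin// mul0e mulNe -EFinM.
move=> mg; have mgE : measurable_fun setT (EFin \o g) by exact/measurable_EFinP.
rewrite !aux//; congr (_ - _); apply: ge0_weighted_transfer => //.
  exact: measurable_funepos.
exact: measurable_funeneg.
Qed.

End weighted_transfer.

(* The weights D^\+ and D^\- of D = Y - Z have the same image under W, so that
   W * D has integral zero. *)
Lemma cond_exp_mul {d} {T : measurableType d} {R : realType}
    {P : probability T R} {G : set (set T)} {Y Z W : T -> R} :
  is_cond_exp P G Y Z -> g_sigma_algebra_preimage W `<=` G ->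
  measurable_fun setT W ->
  P.-integrable setT (EFin \o Y) ->
  P.-integrable setT (fun w => (W w * Y w)%:E) ->
  P.-integrable setT (fun w => (W w * Z w)%:E) ->
  (\int[P]_w (W w * Y w)%:E = \int[P]_w (W w * Z w)%:E)%E.
Proof.
move=> [_ iZ YZ] WG mW iY iWY iWZ.
pose D w := Y w - Z w.
have iD : P.-integrable setT (EFin \o D).
  apply: (eq_integrable _ (fun w => (Y w)%:E - (Z w)%:E)%E) => //.
  exact: integrableB.
have mD : measurable_fun setT D.
  by apply/measurable_EFinP; exact: measurable_int iD.
have iWD : P.-integrable setT (fun w => (W w * D w)%:E).
  apply: (eq_integrable _ (fun w => (W w * Y w)%:E - (W w * Z w)%:E)%E) => //.
    by move=> w _; rewrite -EFinB /D mulrBr.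
  exact: integrableB.
(* Domination by [W * D] makes the product of [W] with each part of [D] integrable. *)
have dom (g : T -> R) : measurable_fun setT g -> (forall w, `|g w| <= `|D w|) ->
    P.-integrable setT (fun w => (W w * g w)%:E).
  move=> mg gD; apply: le_integrable iWD => //.
    exact/measurable_EFinP/measurable_funM.
  by move=> w _; rewrite /= lee_fin !normrM ler_wpM2l.
have mp : measurable_fun setT D^\+ by exact: measurable_funrpos.
have mn : measurable_fun setT D^\- by exact: measurable_funrneg.
have DE w : D w = D^\+ w - D^\- w by rewrite -[in LHS](funrposBneg D).
have pD w : `|D^\+ w| <= `|D w|.
  by rewrite ger0_norm ?funrpos_ge0// /funrpos ge_max ler_norm normr_ge0.
have nD w : `|D^\- w| <= `|D w|.
  rewrite ger0_norm ?funrneg_ge0// /funrneg ge_max -normrN.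
  by rewrite ler_norm normr_ge0.
have ip : P.-integrable setT (fun w => (W w * D^\+ w)%:E).
  exact: dom.
have in_ : P.-integrable setT (fun w => (W w * D^\- w)%:E).
  exact: dom.
have eqD : (\int[P]_w (W w * D^\+ w)%:E = \int[P]_w (W w * D^\- w)%:E)%E.
  apply: (@weighted_transfer _ _ _ _ _ P W W _ _ _ _ _ _ _ _ _ id) => //.
  move=> A mA.
  have mWA : measurable (W @^-1` A) by rewrite -[_ @^-1` _]setTI; exact: mW.
  (* The preimage of [A] under [W] lies in [G], so [Y] and [Z] have the same integral over it; hence
     so do the two parts of [D]. *)
  have GA : G (W @^-1` A) by apply: WG; exists A => //; rewrite setTI.
  have : (\int[P]_(w in W @^-1` A) (D w)%:E = 0)%E.
    under eq_integral do rewrite EFinB.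
    rewrite integralB//; [|exact: integrableS iY|exact: integrableS iZ].
    rewrite YZ// subee//; apply: integrable_fin_num => //.
    exact: integrableS iY.
  under [X in X = _ -> _]eq_integral do rewrite DE EFinB.
  have iA (g : T -> R) : measurable_fun setT g ->
      (forall w, `|g w| <= `|D w|) ->
      P.-integrable (W @^-1` A) (EFin \o g).
    move=> mg gD; apply: (@integrableS _ _ _ _ setT) => //.
    apply: le_integrable iD => //; first exact/measurable_EFinP.
    by move=> w _; rewrite /= lee_fin.
  have ipA := iA _ mp pD; have inA := iA _ mn nD.
  rewrite integralB//= => /eqP.
  by rewrite sube_eq ?add0e ?fin_num_adde_defl ?integrable_fin_num// => /eqP.
have WD0 : (\int[P]_w (W w * D w)%:E = 0)%E.
  under eq_integral do rewrite DE mulrBr EFinB.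
  by rewrite integralB//= eqD subee// integrable_fin_num.
move: WD0; under [X in X = _ -> _]eq_integral do rewrite /D mulrBr EFinB.
rewrite integralB//= => /eqP.
by rewrite sube_eq ?add0e ?fin_num_adde_defl ?integrable_fin_num// => /eqP.
Qed.

(** * Measurability of the evolution density *)

Lemma measurable_partial_integral {d1 d2} {T1 : measurableType d1}
    {T2 : measurableType d2} {R : realType}
    (m : {sigma_finite_measure set T1 -> \bar R}) (f : T1 * T2 -> \bar R) :
  measurable_fun setT f ->
  measurable_fun setT (fun y => (\int[m]_x f (x, y))%E).
Proof.
move=> mf; under eq_fun do rewrite integralE.
(* Tonelli covers nonnegative functions, so the two parts are treated separately. *)
apply: emeasurable_funB.
- have -> : (fun y => (\int[m]_x ((fun x => f (x, y))^\+)%E x)%E) =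
      fubini_G m (f^\+)%E.
    by apply/funext => y; apply: eq_integral => x _; rewrite !funeposE.
  by apply: measurable_fun_fubini_tonelli_G => //; exact: measurable_funepos.
- have -> : (fun y => (\int[m]_x ((fun x => f (x, y))^\-)%E x)%E) =
      fubini_G m (f^\-)%E.
    by apply/funext => y; apply: eq_integral => x _; rewrite !funenegE.
  by apply: measurable_fun_fubini_tonelli_G => //; exact: measurable_funeneg.
Qed.

Lemma measurable_evolution_density {R : realType} {E : ptopologicalType}
    (F : R -> borel E -> R) (t : R) :
  measurable_fun [set p : R * borel E | 0 <= p.1] (fun p => F p.1 p.2) ->
  measurable_fun setT (evolution_density F t).
Proof.
move=> mF; apply: measurableT_comp => //.
(* [F] is only known to be measurable at nonnegative times, so it is extended by zero outside
   [[0, t]] before integrating in [u]. *)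
pose D : set (R * borel E) := `[0, t]%classic `*` setT.
have mD : measurable D by exact: measurableX.
pose g := (fun p : R * borel E => (F p.1 p.2)%:E) \_ D.
have mg : measurable_fun setT g.
  apply/(measurable_restrictT _ mD)/measurable_EFinP.
  apply: measurable_funS mF => //; last first.
    by move=> -[u z] [/= + _]; rewrite in_itv/= => /andP[].
  rewrite (_ : [set _ | _] = `[0, +oo[%classic `*` setT).
    exact: measurableX.
  by apply/seteqP; split=> -[u z]/=; rewrite in_itv/= andbT// => -[].
apply: measurableT_comp => //.
rewrite (_ : (fun z => _) = (fun z => \int[lebesgue_measure]_u g (u, z))%E).
  exact: measurable_partial_integral.
apply/funext => z; rewrite integral_mkcond; apply: eq_integral => u _.
rewrite /g !patchE; congr (if _ then _ else _).
by apply/idP/idP; rewrite !inE => //= -[].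
Qed.

Lemma evolution_density_gt0 {R : realType} {E : ptopologicalType}
  (F : R -> borel E -> R) t z : 0 < evolution_density F t z.
Proof. exact: expR_gt0. Qed.

(** * The FOED identity for unbounded functions *)

Section evolution.
Context {d} {T : measurableType d} {R : realType} {P : probability T R}.
Context {E : ptopologicalType} {X : R -> {RV P >-> borel E}}.
Context {F : R -> borel E -> R}.
Hypothesis XF : evolution_of_distribution X F.
Variables (t : R) (g : borel E -> R).
Hypotheses (t0 : 0 <= t) (mg : measurable_fun setT g).

Let rho z := evolution_density F t z.

Let mrho : measurable_fun setT rho.
Proof. by case: XF => mF _ _; exact: measurable_evolution_density. Qed.

Let mX s : measurable_fun setT (X s). Proof. exact: measurable_funP. Qed.

(** The FOED identity tested on indicators: weighting by [rho (X 0)] turns the law of [X 0] into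
    that of [X t]. The constant weight 1 gives the right side the shape of [pq]. *)
Let law_eq A : measurable A ->
  (\int[P]_(w in X 0%R @^-1` A) (rho (X 0%R w))%:E =
   \int[P]_(w in X t @^-1` A) (cst 1%R w)%:E)%E.
Proof.
move=> mA; case: XF => _ _ /(_ \1_A t) FE.
have bA : bounded_borel (\1_A : borel E -> R).
  split; first exact: measurable_indic.
  exists 1; split; first exact: num_real.
  move=> x /ltW x1 y _; rewrite /= indicE (le_trans _ x1)//.
  by case: (_ \in _); rewrite ?normr0 ?normr1.
have := FE bA t0; rewrite unlock => FA.
rewrite integral_mkcond [RHS]integral_mkcond.
have memE s w : (w \in X s @^-1` A) = (X s w \in A).
  by apply/idP/idP; rewrite !inE.
transitivity (\int[P]_x (\1_A (X 0 x) * evolution_density F t (X 0 x))%:E)%E.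
  apply: eq_integral => w _; rewrite patchE indicE memE.
  by case: ifP; rewrite ?mul1r ?mul0r.
rewrite -FA; apply: eq_integral => w _.
by rewrite patchE indicE memE; case: ifP.
Qed.

(** Needed because [Lambda s q] is integrable but possibly unbounded. *)
Lemma evolution_integrable :
  P.-integrable setT (fun w => (g (X t w))%:E) ->
  P.-integrable setT
    (fun w => (g (X 0 w) * evolution_density F t (X 0 w))%:E).
Proof.
move=> ig; apply: (@weighted_transfer_integrable _ _ _ _ _ P (X 0) (X t)
  (rho \o X 0) (cst 1)) => //.
- exact: measurableT_comp.
- by move=> w; exact/ltW/evolution_density_gt0.
- by apply: eq_integrable ig => // w _; rewrite mulr1.
Qed.

Lemma evolution_integral :
  (\int[P]_w (g (X t w))%:E =
   \int[P]_w (g (X 0%R w) * evolution_density F t (X 0%R w))%:E)%E.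
Proof.
have := @weighted_transfer _ _ _ _ _ P (X 0) (X t) (rho \o X 0) (cst 1).
move=> /(_ _ _ _ _ _ _ _ g) -> //.
- by apply: eq_integral => w _; rewrite mulr1.
- exact: measurableT_comp.
- by move=> w; exact/ltW/evolution_density_gt0.
Qed.

End evolution.

(** * Bounded Borel functions and their averages over a kernel *)

Lemma bounded_funP {T : Type} {R : realType} (f : T -> R) :
  bounded_fun f <-> exists M, forall x, `|f x| <= M.
Proof.
split=> [[M [_ fM]]|[M fM]].
  (* Boundedness only gives bounds by numbers strictly above [M]. *)
  by exists (M + 1) => x; apply: fM => //; rewrite ltrDl.
exists M; split; first exact: num_real.
by move=> x /ltW Mx y _; rewrite /= (le_trans (fM y)).
Qed.

Lemma bounded_fun_comp {T U : Type} {R : realType} (f : U -> R) (g : T -> U) :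
  bounded_fun f -> bounded_fun (f \o g).
Proof.
move=> /bounded_funP[M fM]; apply/bounded_funP; exists M => x; exact: fM.
Qed.

Lemma bounded_borelM {R : realType} {E : ptopologicalType}
    (f g : borel E -> R) :
  bounded_borel f -> bounded_borel g -> bounded_borel (fun z => f z * g z).
Proof.
move=> [mf /bounded_funP[M fM]] [mg /bounded_funP[N gN]]; split.
  exact: measurable_funM.
by apply/bounded_funP; exists (M * N) => z; rewrite normrM ler_pM.
Qed.

(** A bound for [v] also bounds its averages, since [kappa x] has mass one. This keeps the test
    functions of the induction in the same class. *)
Lemma bounded_borel_kernel {R : realType} {E : ptopologicalType}
    (kappa : R.-pker borel E ~> borel E) (v : borel E -> R) :
  bounded_borel v -> bounded_borel (fun x => \int[kappa x]_y v y).
Proof.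
move=> [mv bv]; have mvE : measurable_fun setT (EFin \o v).
  exact/measurable_EFinP.
split.
  apply: measurableT_comp => //; under eq_fun do rewrite integralE.
  apply: emeasurable_funB; apply: measurable_fun_integral_kernel.
  - by move=> U mU; exact: measurable_kernel.
  - by move=> y; exact: funepos_ge0.
  - exact: measurable_funepos.
  - by move=> U mU; exact: measurable_kernel.
  - by move=> y; exact: funeneg_ge0.
  - exact: measurable_funeneg.
move/bounded_funP: (bv) => [M vM]; apply/bounded_funP; exists M => x.
have M0 : 0 <= M by apply: le_trans (vM point).
have iv : (kappa x).-integrable setT (EFin \o v).
  apply: measurable_bounded_integrable => //.
  by rewrite prob_kernel ltry.
apply: (le_trans (le_normr_Rintegral _ iv)) => //.
rewrite -lee_fin fineK; last first.
  by apply: integrable_fin_num => //; exact: integrable_norm.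
apply: (le_trans (@integral_le_bound _ _ _ (kappa x) setT (EFin \o v) M%:E
  _ _ _ _)) => //.
  by apply: aeW => y _; rewrite lee_fin.
by rewrite prob_kernel mule1.
Qed.

Lemma g_sigma_algebra_preimage_comp {d1 d2} {T : pointedType}
    {U : measurableType d1} {V : measurableType d2} (g : T -> U) (f : U -> V) :
  measurable_fun setT f ->
  g_sigma_algebra_preimage (f \o g) `<=` g_sigma_algebra_preimage g.
Proof.
move=> mf _ [B mB <-]; exists (f @^-1` B); last by rewrite !setTI.
by rewrite -[_ @^-1` _]setTI; exact: mf.
Qed.

(** * Products of past values and the filtration *)

Section natural_filtration.
Context {d} {T : measurableType d} {R : realType} {P : probability T R}.
Context {E : ptopologicalType} (X : R -> {RV P >-> borel E}).

(** The right side is an intersection over times [r > s], and every generator up to time [s] is one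
    up to time [r]. The Markov property can thus be tested against functions of the past values. *)
Lemma natural_filtration_augmented s :
  natural_filtration X s `<=` augmented_filtration X s.
Proof.
move=> A As r /=; rewrite in_itv/= andbT => sr.
apply: sub_sigma_algebra; left; apply: sub_sigma_algebra2 As.
move=> B [u /=]; rewrite in_itv/= => /andP[u0 us] uB; exists u => //=.
by rewrite in_itv/= u0 (le_trans us (ltW sr)).
Qed.

Lemma natural_filtration_prod (n : nat) (t : nat -> R) (f : nat -> borel E -> R)
    (s : R) :
  (forall k, (k < n)%N -> 0 <= t k <= s) ->
  (forall k, (k < n)%N -> measurable_fun setT (f k)) ->
  g_sigma_algebra_preimage (fun w => \prod_(k < n) f k (X (t k) w)) `<=`
  natural_filtration X s.
Proof.
move=> ts mf.
pose G := \bigcup_(s in `[0, s]) g_sigma_algebra_preimage (X s).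
(* The sample space is re-equipped with the sigma-algebra generated by [G], so that the claim
   becomes measurability of a finite product. *)
pose W (w : g_sigma_algebraType G) : R := \prod_(k < n) f k (X (t k) w).
have mW : measurable_fun setT W.
  apply: measurable_prod => k _ _ B mB; rewrite setTI.
  apply: sub_sigma_algebra; exists (t k); first by rewrite /= in_itv/= ts.
  apply: (g_sigma_algebra_preimage_comp (X (t k)) (f k) (mf _ (ltn_ord k))).
  by exists B => //; rewrite setTI.
by move=> _ [B mB <-]; exact: mW.
Qed.

End natural_filtration.

(** * One step of the Markov property and of the bridge operator *)

Section one_step.
Context {d} {T : measurableType d} {R : realType} {P : probability T R}.
Context {E : ptopologicalType} {X : R -> {RV P >-> borel E}}.

Let mX s : measurable_fun setT (X s). Proof. exact: measurable_funP. Qed.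

Lemma integrable_bounded_borelM {W : T -> R} {v : borel E -> R} {s : R} :
  P.-integrable setT (EFin \o W) -> bounded_borel v ->
  P.-integrable setT (fun w => (W w * v (X s w))%:E).
Proof.
move=> iW [mv bv].
apply: (eq_integrable _ ((EFin \o W) \* (EFin \o (v \o X s)))%E) => //.
apply: integrableMl => //; first exact: measurableT_comp.
exact: bounded_fun_comp.
Qed.

Lemma integrable_bounded_borel {v : borel E -> R} {s : R} :
  bounded_borel v -> P.-integrable setT (fun w => (v (X s w))%:E).
Proof.
move=> bv; apply: (eq_integrable _ (fun w => (cst 1 w * v (X s w))%:E)) => //.
  by move=> w _; rewrite mul1r.
by apply: integrable_bounded_borelM => //; exact: finite_measure_integrable_cst.
Qed.

Lemma integrable_bounded_borel_prod {n : nat} {t : nat -> R}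
    {f : nat -> borel E -> R} :
  (forall k, (k < n)%N -> bounded_borel (f k)) ->
  P.-integrable setT (fun w => (\prod_(k < n) f k (X (t k) w))%:E).
Proof.
elim: n => [_|n IH bf].
  under eq_fun do rewrite big_ord0.
  exact: finite_measure_integrable_cst.
under eq_fun do rewrite big_ord_recr.
apply: integrable_bounded_borelM; last exact: bf.
by apply: IH => k kn; apply: bf; exact: ltnW.
Qed.

(** An instance of [cond_exp_mul]. The weight [W] is only integrable: it will be a product of
    bounded past factors, but also [q (X 0)], which may be unbounded. *)
Lemma markov_integral {kappa : R.-pker borel E ~> borel E} {s u : R}
    {v : borel E -> R} {W : T -> R} :
  is_cond_exp P (augmented_filtration X s) (fun w => v (X u w))
    (fun w => \int[kappa (X s w)]_y v y) ->
  bounded_borel v -> P.-integrable setT (EFin \o W) ->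
  g_sigma_algebra_preimage W `<=` natural_filtration X s ->
  (\int[P]_w (W w * v (X u w))%:E =
   \int[P]_w (W w * \int[kappa (X s w)]_y v y)%:E)%E.
Proof.
move=> vE bv iW Ws; apply: (cond_exp_mul vE).
- by move=> A /Ws; exact: natural_filtration_augmented.
- by apply/measurable_EFinP; exact: measurable_int iW.
- exact: integrable_bounded_borel.
- exact: integrable_bounded_borelM.
- exact: (integrable_bounded_borelM iW (bounded_borel_kernel kappa v bv)).
Qed.

Variables (F : R -> borel E -> R).
Variables (Lambda : R -> (borel E -> R) -> borel E -> R).
Hypotheses (XF : evolution_of_distribution X F) (XL : bridge_operator X Lambda).

(** The middle conclusion comes from integrability of [Lambda s q (X s)], carried to time 0; it is
    what makes the next function in the recursion integrable, so that the bridge operator applies to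
    it. *)
Lemma bridge_step {q : borel E -> R} {s : R} : measurable_fun setT q ->
  P.-integrable setT (fun w => (q (X 0 w))%:E) -> 0 <= s ->
  [/\ measurable_fun setT (Lambda s q),
      P.-integrable setT
        (fun w => (evolution_density F s (X 0 w) * Lambda s q (X 0 w))%:E) &
      forall v, bounded_borel v ->
      (\int[P]_w (q (X 0%R w) * v (X s w))%:E =
       \int[P]_w (v (X 0%R w) * evolution_density F s (X 0%R w)
                    * Lambda s q (X 0%R w))%:E)%E].
Proof.
move=> mq iq s0.
have igq : (initial_distribution X).-integrable setT (EFin \o q).
  by apply: integrable_pushforward => //; exact/measurable_EFinP.
have [_ /(_ _ s0) mL /(_ _ s0) LE] := XL q igq.
have iL : P.-integrable setT (fun w => (Lambda s q (X s w))%:E) by case: LE.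
split=> // [|v bv].
  apply: eq_integrable (evolution_integrable XF s _ s0 mL iL) => //.
  by move=> w _; rewrite mulrC.
have mv : measurable_fun setT v by case: bv.
under eq_integral do rewrite mulrC.
rewrite (cond_exp_mul (W := v \o X s) LE)//.
- rewrite (evolution_integral XF s (fun z => v z * Lambda s q z) s0);
    last exact: measurable_funM.
  by apply: eq_integral => w _; rewrite mulrAC.
- exact: g_sigma_algebra_preimage_comp.
- exact: measurableT_comp.
- apply: eq_integrable (integrable_bounded_borelM iq bv) => //.
  by move=> w _; rewrite mulrC.
- apply: eq_integrable (integrable_bounded_borelM iL bv) => //.
  by move=> w _; rewrite mulrC.
Qed.

End one_step.

(** * Induction over the times *)

Theorem theorem4p1 (R : realType) (d : measure_display) (T : measurableType d)
    (P : probability T R) (E : ptopologicalType)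
    (X : R -> {RV P >-> borel E})
    (F : R -> borel E -> R)
    (Lambda : R -> (borel E -> R) -> borel E -> R)
    (n : nat) (t : nat -> R) (f h : nat -> borel E -> R) :
  measure_is_complete P ->
  polish R E ->
  cadlag X ->
  non_atomic (initial_distribution X) ->
  measure_support (initial_distribution X) = setT ->
  homogeneous_markov X ->
  evolution_of_distribution X F ->
  bridge_operator X Lambda ->
  (1 <= n)%N ->
  t 0%N = 0 ->
  (forall k, (k < n)%N -> t k < t k.+1) ->
  (forall k, (k <= n)%N -> bounded_borel (f k)) ->
  h 1%N = Lambda (t 1%N) (f 0%N) ->
  (forall k, (1 <= k <= n.-1)%N ->
     h k.+1 = Lambda (t k.+1 - t k)
       (fun z => f k z * evolution_density F (t k - t k.-1) z * h k z)) ->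
  ('E_P[fun w => (\prod_(k < n.+1) f k (X (t k) w))%R] =
   'E_P[fun w => (f n (X 0 w) * evolution_density F (t n - t n.-1) (X 0 w)
                 * h n (X 0 w))%R])%E.
Proof.
move=> _ _ _ _ _ [kappa kappaE] XF XL n1 t0 tS bf h1 hS.
have mF s : measurable_fun setT (evolution_density F s).
  by case: XF => mF _ _; exact: measurable_evolution_density.
have tle j k : (j <= k <= n)%N -> t j <= t k.
  elim: k => [|k IH]; first by case: j.
  move=> /andP[]; rewrite leq_eqVlt => /predU1P[->//|jk] kn.
  by rewrite (le_trans (IH _) (ltW (tS _ _)))// -ltnS jk ltnW.
have mX s : measurable_fun setT (X s) by exact: measurable_funP.
have mf k : (k <= n)%N -> measurable_fun setT (f k) by move=> /bf[].
(* The index is shifted by one to avoid predecessors; the result is the case [m = n.-1], [v = f n].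
   The first two clauses feed [bridge_step] at the next stage. *)
suff main m : (m < n)%N ->
    [/\ measurable_fun setT (h m.+1),
        P.-integrable setT (fun w =>
          (evolution_density F (t m.+1 - t m) (X 0 w) * h m.+1 (X 0 w))%:E) &
        forall v, bounded_borel v ->
        (\int[P]_w (\prod_(k < m.+1) f k (X (t k) w) * v (X (t m.+1) w))%:E =
         \int[P]_w (v (X 0%R w) * evolution_density F (t m.+1 - t m) (X 0%R w)
                      * h m.+1 (X 0%R w))%:E)%E].
  have nE : n = n.-1.+1 by rewrite prednK.
  have [|_ _ /(_ _ (bf n (leqnn n)))] := main n.-1; first by rewrite prednK.
  rewrite -nE expectation.unlock => H; rewrite -[RHS]H.
  apply: eq_integral => w _.
  by rewrite /= big_ord_recr.
elim: m => [_|m IH mn].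
  (* The first interval starts at [t 0 = 0], so one bridge step with [q = f 0] suffices. *)
  have [|||mL iL LE] := bridge_step _ _ XF XL (q := f 0%N) (s := t 1%N).
  - exact: mf.
  - exact: (integrable_bounded_borel (bf 0%N isT)).
  - by rewrite -t0 tle.
  rewrite t0 subr0 h1; split=> // v bv.
  under eq_integral do rewrite big_ord1 t0.
  exact: LE.
have [mh ih IHv] := IH (ltnW mn).
pose q z := f m.+1 z * evolution_density F (t m.+1 - t m) z * h m.+1 z.
have mq : measurable_fun setT q.
  apply: measurable_funM => //; apply: measurable_funM => //.
  exact: mf (ltnW mn).
(* A bounded factor [f m.+1] times the integrable function of the induction hypothesis. *)
have iq : P.-integrable setT (fun w => (q (X 0 w))%:E).
  apply: eq_integrable
    (integrable_bounded_borelM (s := 0) ih (bf _ (ltnW mn))) => //.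
  by move=> w _; rewrite /q mulrC mulrA.
pose s := t m.+2 - t m.+1.
have s0 : 0 <= s by rewrite subr_ge0 tle// leqnSn.
have tm0 : 0 <= t m.+1 by rewrite -t0 tle //= ltnW.
have [mL iL LE] := bridge_step _ _ XF XL mq iq s0.
(* For [k = m.+1] the argument of [Lambda] is [q], and [k <= n.-1] amounts to [m.+1 < n]. *)
rewrite hS//; last by rewrite /= -ltnS prednK.
split=> // v bv.
have := kappaE _ s v tm0 s0 bv; rewrite addrC subrK => tE.
rewrite (markov_integral tE)//; last 2 first.
- apply: (integrable_bounded_borel_prod (n := m.+2) (t := t) (f := f)) => k km.
  by apply: bf; rewrite -ltnS (leq_trans km)// ltnW.
- apply: (@natural_filtration_prod _ _ _ _ _ X m.+2 t f) => k km.
    apply/andP; split; last by apply: tle; rewrite -ltnS km ltnW.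
    by rewrite -t0 tle//= (leq_trans (ltnW km)).
  by apply: mf; exact: leq_trans (ltnW km) mn.
(* The last factor of the product joins the kernel average: the induction hypothesis is used with
   the test function [f m.+1] times the average of [v] under [kappa s]. *)
under eq_integral do rewrite big_ord_recr/= -mulrA.
rewrite (IHv _ (bounded_borelM _ _ (bf _ (ltnW mn))
  (bounded_borel_kernel (kappa s) v bv))).
(* By homogeneity the same kernel [kappa s] describes the step from time 0 to time [s]. *)
have := kappaE 0 s v (lexx 0) s0 bv; rewrite add0r => sE.
rewrite -(LE v bv) (markov_integral sE)//.
  apply: eq_integral => w _; congr (_%:E).
  by rewrite /q -!mulrA; congr (_ * _); rewrite mulrC -mulrA.
(* The weight [q (X 0)] is measurable with respect to the filtration at time 0. *)
move=> A /(g_sigma_algebra_preimage_comp (X 0) q mq) A0.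
apply: sub_sigma_algebra; exists 0 => //.
by rewrite /= in_itv/= lexx.
Qed.
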